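(* Let $n>2$, $i\in[n-1]$ and let $w\in S_n$ be such that $ws_i=w_0$, the longest element of $S_n$. If $n$ is odd assume moreover $i\ne\frac{n+1}{2}$. Then the degenerate Schubert variety $X^a_w$ is reducible.
   Context: Notation: $[a,b]=\{a,\dots,b\}$, $[b]=[1,b]$; $S_n$ is the symmetric group with simple reflections $s_i=(i,i+1)$. For $v\in S_n$, $v([k])=\{v(1),\dots,v(k)\}$; for $k$-subsets $I=\{a_1<\dots<a_k\}$, $K=\{b_1<\dots<b_k\}$ of $[n]$, $I\le K$ iff $a_r\le b_r$ for all $r$. $A_n=\mathbb C[p_I:I\subseteq[n],1\le|I|\le n-1]$; for a sequence of distinct elements, $p$ of the sequence is the signed coordinate of its underlying set, $0$ if entries repeat. Plücker relations: for sequences $J=(j_1,\dots,j_e)$, $L=(l_1,\dots,l_d)$ of distinct elements of $[n]$ with $1\le e\le d\le n-1$ and $k\in[e]$, $R^k_{J,L}=p_Jp_L-\sum_{1\le r_1<\dots<r_k\le d}p_{J'}p_{L'}$, with $J'$ obtained from $J$ by replacing $j_t$ by $l_{r_t}$ and $L'$ from $L$ by replacing $l_{r_t}$ by $j_t$. $\mathcal I_{\mathrm{Fl}_n}$ is generated by all $R^k_{J,L}$, and $\mathcal I_v=\mathcal I_{\mathrm{Fl}_n}+(p_I:I\not\le v([|I|]))$ is the ideal of the Schubert variety $X_v$. Weight $\mathbf w_I=\#\{a\in I:|I|\le a\le n-1\}$; $\operatorname{in}_{\mathbf w}(f)$ is the sum of the terms of $f$ of minimal weight (weight of $\prod p_I^{\alpha_I}$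 is $\sum\alpha_I\mathbf w_I$); $\operatorname{in}_{\mathbf w}(\mathcal I)$ is generated by the $\operatorname{in}_{\mathbf w}(f)$, $f\in\mathcal I$. The degenerate Schubert variety is $X^a_v=V(\operatorname{in}_{\mathbf w}(\mathcal I_v))\subseteq\prod_{k=1}^{n-1}\mathbb P(\wedge^k\mathbb C^n)$. *)

(* Defs.v *)
From mathcomp Require Import all_boot all_order all_fingroup all_algebra.
From mathcomp Require Import reals complex mpoly.
Set Implicit Arguments. Unset Strict Implicit. Unset Printing Implicit Defensive.
Import GRing.Theory.
Local Open Scope ring_scope.

(* Elements of [n] = {1,..,n} are represented by a : 'I_n, standing for a.+1. *)

(* Index set of the Pluecker variables: subsets I of [n] with 1 <= |I| <= n-1. *)
Definition PT (n : nat) := {S : {set 'I_n} | (0 < #|S| < n)%N}.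
Definition Nv (n : nat) := #|{: PT n}|.
Notation An C n := {mpoly C[Nv n]}.

Definition pvar (C : nzRingType) n (S : PT n) : An C n := 'X_(enum_rank S).

(* number of inversions of a sequence of naturals: the signature of the
   permutation sorting a sequence of distinct elements is (-1)^inv *)
Definition inv_count (s : seq nat) : nat :=
  \sum_(i < size s) \sum_(j < size s) ((i < j) && (nth 0 s j < nth 0 s i))%N.

Definition pseq (C : nzRingType) n (s : seq 'I_n) : An C n :=
  if uniq s then
    match insub [set x in s] : option (PT n) with
    | Some P => (-1) ^+ inv_count (map val s) *: pvar C P
    | None => 0
    end
  else 0.

(* J' and L' of the Pluecker relation, for the set R of (0-based) positions
   {r_1 < ... < r_k} in L *)
Definition Jrep n (J L : seq 'I_n) (k : nat) (rs : seq nat) : seq 'I_n :=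
  [seq (let: (t, j) := tj in if (t < k)%N then nth j L (nth 0%N rs t) else j)
  | tj <- zip (iota 0 (size J)) J].
Definition Lrep n (J L : seq 'I_n) (rs : seq nat) : seq 'I_n :=
  [seq (let: (u, l) := ul in if u \in rs then nth l J (index u rs) else l)
  | ul <- zip (iota 0 (size L)) L].

Definition plucker_rel (C : nzRingType) n (J L : seq 'I_n) (k : nat) : An C n :=
  pseq C J * pseq C L
  - \sum_(R : {set 'I_(size L)} | #|R| == k)
      (let rs := sort leq (map val (enum R)) in
       pseq C (Jrep J L k rs) * pseq C (Lrep J L rs)).

Definition FlGen (C : nzRingType) n (f : An C n) : Prop :=
  exists (J L : seq 'I_n) (k : nat),
    [/\ uniq J && uniq L, (1 <= size J <= size L)%N, (size L <= n - 1)%N,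
        (1 <= k <= size J)%N & f = plucker_rel C J L k].

Definition in_ideal (C : nzRingType) N (G : {mpoly C[N]} -> Prop) (f : {mpoly C[N]}) : Prop :=
  exists s : seq ({mpoly C[N]} * {mpoly C[N]}),
    (forall x, x \in s -> G x.2) /\ f = \sum_(x <- s) x.1 * x.2.

Definition vset n (v : 'S_n) (k : nat) : {set 'I_n} := v @: [set j : 'I_n | (j.+1 <= k)%N].

Definition subset_le n (I K : {set 'I_n}) : bool :=
  all2 (fun a b => (a <= b)%N) (sort leq (map val (enum I))) (sort leq (map val (enum K))).

Definition SchGen (C : nzRingType) n (v : 'S_n) (f : An C n) : Prop :=
  FlGen f \/
  exists S : PT n, ~~ subset_le (val S) (vset v #|val S|) /\ f = pvar C S.

(* weight w_I = #{a in I : |I| <= a <= n-1}  (a.+1 is the 1-based label) *)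
Definition wI n (S : PT n) : nat :=
  #|[set a in val S | (#|val S| <= a.+1 <= n - 1)%N]|.

Definition mwt n (m : 'X_{1.. Nv n}) : nat :=
  \sum_(x : 'I_(Nv n)) (m x * wI (enum_val x))%N.

Definition minwt (C : nzRingType) n (f : An C n) : nat :=
  \big[minn/mwt (head 0%MM (msupp f))]_(m <- msupp f) mwt m.

Definition inw (C : nzRingType) n (f : An C n) : An C n :=
  \sum_(m <- msupp f | mwt m == minwt f) f@_m *: 'X_[m].

(* Points of prod_{k=1}^{n-1} P(wedge^k C^n), represented by (affine-cone)
   coordinate vectors x : PT n -> C, each block (x_I)_{|I|=k} being nonzero. *)
Definition evalp (C : comNzRingType) n (f : An C n) (x : PT n -> C) : C :=
  f.@[fun i => x (enum_val i)].

Definition admissible (C : nzRingType) n (x : PT n -> C) : Prop :=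
  forall k : nat, (0 < k < n)%N -> exists S : PT n, #|val S| = k /\ x S != 0.

Definition degSchubert (C : comNzRingType) n (v : 'S_n) (x : PT n -> C) : Prop :=
  admissible x /\
  forall g : An C n,
    in_ideal (fun h => exists f, in_ideal (@SchGen C n v) f /\ h = inw f) g ->
    evalp g x = 0.

Definition blockdeg n (m : 'X_{1.. Nv n}) (k : nat) : nat :=
  \sum_(x : 'I_(Nv n) | #|val (enum_val x)| == k) m x.

Definition multihomog (C : nzRingType) n (f : An C n) : Prop :=
  exists d : nat -> nat, forall m, m \in msupp f -> forall k, blockdeg m k = d k.

Definition zclosed (C : comNzRingType) n (Z : (PT n -> C) -> Prop) : Prop :=
  exists F : An C n -> Prop,
    (forall f, F f -> multihomog f) /\
    forall x, Z x <-> (admissible x /\ forall f, F f -> evalp f x = 0).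

Definition reducible (C : comNzRingType) n (X : (PT n -> C) -> Prop) : Prop :=
  exists Z1 Z2 : (PT n -> C) -> Prop,
    [/\ zclosed Z1, zclosed Z2, (forall x, X x <-> (Z1 x \/ Z2 x)),
        (exists x, X x /\ ~ Z1 x) & (exists x, X x /\ ~ Z2 x)].

(* s_i = (i, i+1) in 1-based labels, i.e. swapping the ordinals i-1 and i *)
Definition ordpred n (i : 'I_n) : 'I_n :=
  Ordinal (leq_ltn_trans (leq_pred i) (ltn_ord i)).
Definition sref n (i : 'I_n) : 'S_n := tperm (ordpred i) i.
Definition w0 n : 'S_n := perm (@rev_ord_inj n).

(* Main.v *)
(** Since [w s_i = w0], the Schubert variety [X_w] is the divisor [p_T = 0] of the flag variety, where
    [T = {n-i+1, .., n}].  Let [e = i] if [2 i <= n] and [e = i - 1] if [2 i >= n + 2].  In a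
    three-term relation between coordinates of sizes [e] and [e + 1] on [X + {z,q,r}],
      [p_(zX) p_(qrX) - p_(qX) p_(zrX) - p_(rX) p_(qzX)],
    taking [z] to be the label [e] makes the first term strictly heavier than the two others, and the
    assumption on [i] is exactly what allows [T] to be [qX] (first case) or [zrX] (second case).
    Modulo [p_T] the initial form of the relation is then the monomial [p_(rX) p_(qzX)], so the
    degenerate variety is the union of its sections by [p_(rX) = 0] and [p_(qzX) = 0].

    Neither section is everything: there are coordinate flags in [X_w] on which the given factor does
    not vanish.  These flags survive in the degeneration because the ideal is multihomogeneous and a
    coordinate flag lies on exactly one monomial of each multidegree, so that an element of the ideal
    has no monomial at all that is nonzero there. *)

From HB Require Import structures.
Require Import Defs.
From mathcomp Require Import all_boot all_order all_fingroup all_algebra.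
From mathcomp Require Import reals complex mpoly zify.
Set Implicit Arguments. Unset Strict Implicit. Unset Printing Implicit Defensive.
Import Order.TTheory GRing.Theory Num.Theory.
Local Open Scope ring_scope.

(** * Projection of a polynomial onto the monomials satisfying a predicate *)

Section MonomialProjection.
Variables (C : nzRingType) (N : nat).
Implicit Types (P Q : pred 'X_{1..N}) (f g h : {mpoly C[N]}).

(** Two instances matter: multihomogeneous components, and the initial form [inw f], which is
    convertible to the projection onto the monomials of minimal weight. *)
Definition mproj P f : {mpoly C[N]} := \sum_(m <- msupp f | P m) f@_m *: 'X_[m].

Lemma mcoeff_mproj P f m : (mproj P f)@_m = if P m then f@_m else 0.
Proof.
rewrite /mproj raddf_sum /=.
rewrite (eq_bigr (fun m' => f@_m' * (m' == m)%:R)); last first.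
  by move=> m' _; rewrite mcoeffZ mcoeffX.
case: (boolP (m \in msupp f)) => [mf|mNf].
  rewrite (bigID (pred1 m)) /= [X in _ + X]big1 ?addr0; last first.
    by move=> m' /andP[_ /negPf->]; rewrite mulr0.
  rewrite -big_filter; case: ifP => Pm.
    rewrite (@eq_filter _ _ (pred1 m)); last first.
      by move=> m' /=; case: eqP => [->|]; rewrite ?andbF ?Pm.
    by rewrite filter_pred1_uniq ?msupp_uniq // big_seq1 eqxx mulr1.
  rewrite (@eq_filter _ _ pred0) ?filter_pred0 ?big_nil // => m' /=.
  by case: eqP => [->|]; rewrite ?andbF ?Pm.
move: (mNf); rewrite -mcoeff_eq0 => /eqP ->; rewrite if_same big_seq_cond big1 //.
move=> m' /andP[m'f _]; case: eqP => [E|]; last by rewrite mulr0.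
by rewrite -E m'f in mNf.
Qed.

Lemma msupp_mproj P f m : (m \in msupp (mproj P f)) = P m && (m \in msupp f).
Proof. by rewrite !mcoeff_msupp mcoeff_mproj; case: (P m); rewrite ?eqxx. Qed.

Lemma mproj_is_additive P : additive (mproj P).
Proof.
move=> f g; apply/mpolyP => m; rewrite mcoeffB !mcoeff_mproj mcoeffB.
by case: (P m); rewrite ?subr0.
Qed.

HB.instance Definition _ P :=
  GRing.isAdditive.Build {mpoly C[N]} {mpoly C[N]} (mproj P) (mproj_is_additive P).

Lemma mprojD_predC P f : f = mproj P f + mproj (predC P) f.
Proof.
by apply/mpolyP => m; rewrite mcoeffD !mcoeff_mproj /=; case: (P m); rewrite ?addr0 ?add0r.
Qed.

Lemma mproj_all P f : (forall m, m \in msupp f -> P m) -> mproj P f = f.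
Proof.
move=> Pf; apply/mpolyP => m; rewrite mcoeff_mproj; case: ifPn => // NPm.
by apply/esym/eqP; rewrite mcoeff_eq0; apply: contra NPm => /Pf.
Qed.

Lemma mproj_none P f : (forall m, m \in msupp f -> ~~ P m) -> mproj P f = 0.
Proof.
move=> Pf; apply/mpolyP => m; rewrite mcoeff_mproj mcoeff0; case: ifP => // Pm.
by apply/eqP; rewrite mcoeff_eq0; apply/negP => /Pf; rewrite Pm.
Qed.

End MonomialProjection.

(** * Multidegrees, multihomogeneous components and their initial forms *)

Section Multidegree.
Variables (C : nzRingType) (n : nat).
Implicit Types (f g h : An C n) (m : 'X_{1.. Nv n}).

(** No variable has a block index of [n] or more, so this finite function determines [blockdeg m],
    and it has decidable equality. *)
Definition mdegb m : {ffun 'I_n -> nat} := [ffun k : 'I_n => blockdeg m k].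

Lemma blockdegE m k :
  blockdeg m k = if insub k is Some k' then mdegb m k' else 0%N.
Proof.
case: insubP => [k' _ <-|]; first by rewrite ffunE.
rewrite -leqNgt => nk; apply: big1 => x /eqP Ek.
by case/andP: (valP (enum_val x)) => _; rewrite Ek ltnNge nk.
Qed.

Lemma blockdegD m1 m2 k : blockdeg (m1 + m2)%MM k = (blockdeg m1 k + blockdeg m2 k)%N.
Proof. by rewrite /blockdeg -big_split; apply: eq_bigr => x _; rewrite mnmDE. Qed.

Lemma blockdegU (S : PT n) k : blockdeg U_(enum_rank S)%MM k = (#|val S| == k).
Proof.
rewrite /blockdeg big_mkcond (bigD1 (enum_rank S)) //= enum_rankK mnm1E eqxx.
rewrite big1 => [|x xS]; first by case: eqP.
by rewrite mnm1E (eq_sym _ x) (negPf xS) if_same.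
Qed.

Definition bhomog (d : nat -> nat) f := forall m, m \in msupp f -> blockdeg m =1 d.

Lemma bhomog0 d : bhomog d 0.
Proof. by move=> m; rewrite msupp0. Qed.

Lemma bhomogD d f g : bhomog d f -> bhomog d g -> bhomog d (f + g).
Proof.
by move=> hf hg m /msuppD_le; rewrite mem_cat => /orP[/hf|/hg].
Qed.

Lemma bhomogN d f : bhomog d f -> bhomog d (- f).
Proof. by move=> hf m; rewrite (perm_mem (msuppN f)) => /hf. Qed.

Lemma bhomogZ d c f : bhomog d f -> bhomog d (c *: f).
Proof. by move=> hf m /msuppZ_le /hf. Qed.

Lemma bhomogM d e f g : bhomog d f -> bhomog e g -> bhomog (fun k => d k + e k)%N (f * g).
Proof.
move=> hf hg m /msuppM_le /allpairsP[[m1 m2] /= [/hf E1 /hg E2 ->]] k.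
by rewrite blockdegD E1 E2.
Qed.

Lemma bhomog_pvar (S : PT n) : bhomog (fun k => #|val S| == k) (pvar C S).
Proof.
by move=> m; rewrite msuppX inE => /eqP-> k; rewrite blockdegU.
Qed.

Lemma bhomog_pseq (s : seq 'I_n) : bhomog (fun k => size s == k) (pseq C s).
Proof.
rewrite /pseq; case: ifP => us; last exact: bhomog0.
case: insubP => [P _ EP|_]; last exact: bhomog0.
apply: bhomogZ => m /bhomog_pvar Em k; rewrite Em EP cardsE.
by rewrite (card_uniqP us).
Qed.

Lemma size_Jrep (J L : seq 'I_n) k rs : size (Jrep J L k rs) = size J.
Proof. by rewrite size_map size_zip size_iota minnn. Qed.

Lemma size_Lrep (J L : seq 'I_n) rs : size (Lrep J L rs) = size L.
Proof. by rewrite size_map size_zip size_iota minnn. Qed.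

Lemma bhomog_plucker (J L : seq 'I_n) k :
  bhomog (fun j => (size J == j) + (size L == j))%N (plucker_rel C J L k).
Proof.
apply: bhomogD; first by apply: bhomogM; exact: bhomog_pseq.
apply: bhomogN; apply: big_ind; [exact: bhomog0|exact: bhomogD|] => R _ /=.
set rs := sort _ _; rewrite -{1}(size_Jrep J L k rs) -{1}(size_Lrep J L rs).
by apply: bhomogM; exact: bhomog_pseq.
Qed.

Lemma SchGen_homog (v : 'S_n) f : SchGen v f -> exists d, bhomog d f.
Proof.
case=> [[J [L [k [_ _ _ _ ->]]]]|[S [_ ->]]].
  by eexists; exact: bhomog_plucker.
by eexists; exact: bhomog_pvar.
Qed.

Lemma bhomog_mproj d P f : bhomog d f -> bhomog d (mproj P f).
Proof. by move=> hf m; rewrite msupp_mproj => /andP[_ /hf]. Qed.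

Lemma bhomog_mdegb d f : (forall m, m \in msupp f -> mdegb m = d) ->
  bhomog (fun k => if insub k is Some k' then d k' else 0%N) f.
Proof. by move=> hf m /hf <- k; rewrite blockdegE. Qed.

(** The factor [g'] is the part of [g] of multidegree [d - e]; the predicate [Q] expresses this
    additively, avoiding truncated subtraction. *)
Lemma mproj_mdegb_mul d e g h : bhomog e h ->
  exists g', mproj (fun m => mdegb m == d) (g * h) = g' * h.
Proof.
move=> hh; pose Q (m : 'X_{1.. Nv n}) := [forall k : 'I_n, blockdeg m k + e k == d k]%N.
have EQ m1 m2 : m2 \in msupp h -> (mdegb (m1 + m2)%MM == d) = Q m1.
  move=> /hh E; apply/eqP/forallP => [<- k|H].
    by rewrite ffunE blockdegD E.
  by apply/ffunP => k; rewrite ffunE blockdegD E (eqP (H k)).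
exists (mproj Q g); rewrite {1}(mprojD_predC Q g) mulrDl raddfD /=.
rewrite [X in X + _]mproj_all => [|m /msuppM_le /allpairsP[[m1 m2] /= []]]; last first.
  by rewrite msupp_mproj => /andP[NQ _] m2h ->; rewrite EQ.
rewrite [X in _ + X]mproj_none ?addr0 // => m /msuppM_le /allpairsP[[m1 m2] /= []].
by rewrite msupp_mproj => /andP[NQ _] m2h ->; rewrite EQ.
Qed.

(** An ideal with multihomogeneous generators contains the components of its elements: each summand
    [g * h] projects to a multiple of the same [h]. *)
Lemma in_ideal_mproj (G : An C n -> Prop) d f :
  (forall h, G h -> exists e, bhomog e h) -> in_ideal G f ->
  in_ideal G (mproj (fun m => mdegb m == d) f).
Proof.
move=> hG [s [sG ->]]; rewrite raddf_sum /=.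
elim: s sG => [|[g h] s IH] sG.
  by exists [::]; split => //; rewrite !big_nil.
have [e he] := hG _ (sG _ (mem_head _ _)).
have [g' E] := mproj_mdegb_mul d g he.
have [|s' [s'G Es]] := IH; first by move=> x xs; apply: sG; rewrite inE xs orbT.
exists ((g', h) :: s'); split; last by rewrite !big_cons E Es.
move=> x; rewrite inE => /predU1P[->|/s'G //]; exact: (sG _ (mem_head _ _)).
Qed.

Lemma minwt_le f m : m \in msupp f -> (minwt f <= mwt m)%N.
Proof.
rewrite /minwt; elim: (msupp f) (mwt _) => // a s IH x.
rewrite inE big_cons geq_min => /predU1P[->|/IH ->]; rewrite ?leqnn ?orbT //.
Qed.

Lemma minwt_attained f m : m \in msupp f -> exists2 m', m' \in msupp f & mwt m' = minwt f.
Proof.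
move=> mf; pose P x := exists2 m', m' \in msupp f & mwt m' = x.
rewrite -/(P (minwt f)) /minwt big_seq; apply: big_ind.
- exists (head 0%MM (msupp f)) => //.
  by case: (msupp f) mf => //= a s _; rewrite mem_head.
- by move=> x y Px Py; rewrite /minn; case: ifP.
by move=> m' m'f; exists m'.
Qed.

Lemma minwt_eq f m : m \in msupp f -> (forall m', m' \in msupp f -> (mwt m <= mwt m')%N) ->
  minwt f = mwt m.
Proof.
move=> mf H; have [m' m'f E] := minwt_attained mf.
by apply/eqP; rewrite eqn_leq minwt_le //= -E H.
Qed.

(** Either some monomial of multidegree [d] attains the minimal weight of [f], and then [fd] has the
    same minimal weight as [f], or none does and the component is zero. *)
Lemma mproj_mdegb_inw d f :
  let fd := mproj (fun m => mdegb m == d) f in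
  mproj (fun m => mdegb m == d) (inw f) = inw fd \/
  mproj (fun m => mdegb m == d) (inw f) = 0.
Proof.
move=> fd; have E m : (mproj (fun m => mdegb m == d) (inw f))@_m =
    if (mdegb m == d) && (mwt m == minwt f) then f@_m else 0.
  by rewrite mcoeff_mproj [inw f]/(mproj _ f) mcoeff_mproj; case: eqP.
case: (boolP (has (fun m => (mdegb m == d) && (mwt m == minwt f)) (msupp f))).
  case/hasP => m mf /andP[/eqP Ed /eqP Em]; left.
  have Emin : minwt fd = minwt f.
    rewrite -Em; apply: minwt_eq; first by rewrite msupp_mproj Ed eqxx.
    by move=> m'; rewrite msupp_mproj Em => /andP[_ /minwt_le].
  apply/mpolyP => m'; rewrite E [inw fd]/(mproj _ fd) !mcoeff_mproj Emin.
  by case: eqP => //=; rewrite if_same.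
move=> /hasPn H; right; apply/mpolyP => m; rewrite E mcoeff0; case: ifP => // Pm.
by apply/eqP; rewrite mcoeff_eq0; apply/negP => /H; rewrite Pm.
Qed.

Lemma mproj_mdegb_sum f :
  f = \sum_(d <- undup (map mdegb (msupp f))) mproj (fun m => mdegb m == d) f.
Proof.
apply/mpolyP => m; rewrite raddf_sum /=.
under eq_bigr do rewrite mcoeff_mproj.
case: (boolP (m \in msupp f)) => mf; last first.
  have /eqP-> : f@_m == 0 by rewrite mcoeff_eq0.
  by rewrite big1 // => d _; rewrite if_same.
rewrite (bigD1_seq (mdegb m)) ?undup_uniq ?mem_undup ?map_f //= eqxx.
by rewrite big1 ?addr0 // => d; rewrite eq_sym => /negPf ->.
Qed.

End Multidegree.

(** * Multihomogeneous equations of the degenerate Schubert variety *)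

Section DegenerateSchubert.
Variables (C : comNzRingType) (n : nat) (v : 'S_n).

(** [zclosed] asks for multihomogeneous equations. Each component of an initial form is zero or the
    initial form of a component of [f], and that component stays in the ideal. *)
Lemma degSchubert_homogP (x : PT n -> C) :
  degSchubert v x <-> admissible x /\
  forall f : An C n, multihomog f -> in_ideal (@SchGen C n v) f -> evalp (inw f) x = 0.
Proof.
split=> [[adx H]|[adx H]]; split=> //.
  move=> f _ If.
  apply: H; exists [:: (1, inw f)]; split; last by rewrite big_seq1 mul1r.
  by move=> y; rewrite inE => /eqP -> /=; exists f.
move=> g [s [sG ->]]; rewrite /evalp raddf_sum /= big_seq big1 // => -[g' h] /sG [f [If /= ->]].
rewrite mevalM (_ : meval _ (inw f) = 0) ?mulr0 //.
rewrite (mproj_mdegb_sum (inw f)) raddf_sum /= big1 // => d _.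
have [->|->] := mproj_mdegb_inw d f; last exact: meval0.
apply: H; last by apply: in_ideal_mproj => //; exact: SchGen_homog.
eexists; apply: (@bhomog_mdegb _ _ d) => m; rewrite msupp_mproj => /andP[/eqP-> //].
Qed.

Lemma zclosed_degSchubert_pvar (S : PT n) :
  zclosed (fun x : PT n -> C => degSchubert v x /\ x S = 0).
Proof.
exists (fun f => (exists g, [/\ multihomog g, in_ideal (@SchGen C n v) g & f = inw g])
          \/ f = pvar C S); split.
  move=> f [[g [[d hd] _ ->]]|->]; first by exists d; exact: bhomog_mproj.
  by eexists; exact: bhomog_pvar.
have Epv x : evalp (pvar C S) x = x S by rewrite /evalp mevalXU enum_rankK.
move=> x; rewrite degSchubert_homogP; split.
  case=> [[adx H] xS]; split => // f [[g [hg Ig ->]]|->]; first exact: H.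
  by rewrite Epv.
case=> adx H; split; last by rewrite -Epv; apply: H; right.
by split => // f hf If; apply: H; left; exists f.
Qed.

End DegenerateSchubert.

(** * Reducibility from a vanishing product of two coordinates *)

Section Reducible.
Variables (C : idomainType) (n : nat) (v : 'S_n).

Lemma reducible_degSchubert (A B : PT n) :
  (forall x : PT n -> C, degSchubert v x -> x A * x B = 0) ->
  (exists x : PT n -> C, degSchubert v x /\ x A != 0) ->
  (exists x : PT n -> C, degSchubert v x /\ x B != 0) ->
  reducible (@degSchubert C n v).
Proof.
move=> H [x [Xx xA]] [y [Xy yB]].
exists (fun x => degSchubert v x /\ x A = 0), (fun x => degSchubert v x /\ x B = 0).
split; try exact: zclosed_degSchubert_pvar.
- move=> z; split => [Xz|[[]|[]] //].
  have /eqP := H z Xz; rewrite mulf_eq0 => /orP[] /eqP E; by [left|right].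
- by exists x; split => // -[_ E]; rewrite E eqxx in xA.
by exists y; split => // -[_ E]; rewrite E eqxx in yB.
Qed.

End Reducible.

(** * Parity of inversion counts under permutations *)

Section Signs.

(** In the product of the differences [s_j - s_i] over [i < j], the negative factors are exactly the
    inversions. This turns [inv_count] into the sign of a determinant. *)
Lemma sgr_Vandermonde m (s : seq nat) : size s = m -> uniq s ->
  Num.sg (\det (Vandermonde m (\row_j (nth 0%N s j)%:Z))) = (-1) ^+ inv_count s.
Proof.
move=> <- us; rewrite det_Vandermonde (big_morph _ (@sgrM _) (@sgr1 _)) /inv_count -prodrXr.
apply: eq_bigr => i _; rewrite (big_morph _ (@sgrM _) (@sgr1 _)) -prodrXr big_mkcond.
apply: eq_bigr => j _ /=; rewrite !mxE; case: ltnP => //= ij.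
have : nth 0%N s i != nth 0%N s j by rewrite nth_uniq // neq_ltn ij.
case: (ltngtP (nth 0%N s i) (nth 0%N s j)) => // H _; rewrite ?expr1 ?expr0.
  by rewrite gtr0_sg // subr_gt0 ltz_nat.
by rewrite ltr0_sg // subr_lt0 ltz_nat.
Qed.

(** Permuting the entries permutes the columns of the Vandermonde matrix, which multiplies its
    determinant by the signature. *)
Lemma odd_inv_count_perm m (s t : seq nat) (sg : 'S_m) :
  size s = m -> size t = m -> uniq s ->
  (forall i : 'I_m, nth 0%N t i = nth 0%N s (sg i)) ->
  odd (inv_count t) = odd_perm sg (+) odd (inv_count s).
Proof.
move=> ss st us E.
have ut : uniq t.
  apply/(uniqP 0%N) => i j; rewrite !inE st => im jm.
  rewrite (E (Ordinal im)) (E (Ordinal jm)) => /eqP.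
  by rewrite nth_uniq ?ss // => /eqP /val_inj /perm_inj [].
have := sgr_Vandermonde st ut.
have -> : Vandermonde m (\row_j (nth 0%N t j)%:Z) =
          col_perm sg (Vandermonde m (\row_j (nth 0%N s j)%:Z)).
  by apply/matrixP => i j; rewrite !mxE E.
rewrite col_permE det_mulmx det_perm odd_permV mulrC sgrM sgr_Vandermonde //.
have -> : Num.sg ((-1) ^+ sg : int) = (-1) ^+ sg by case: (odd_perm sg).
rewrite -(signr_odd _ (inv_count s)) -(signr_odd _ (inv_count t)) -signr_addb => /eqP.
by rewrite (inj_eq (@signr_inj _)) eq_sym => /eqP.
Qed.

(** Write [sg] as a product of transpositions; [h] carries them to transpositions of [U] whose
    product is [tau], so the number of factors agrees. *)
Lemma odd_perm_equivariant (T U : finType) (h : T -> U) (sg : {perm T}) (tau : {perm U}) :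
  injective h -> (forall i, h (sg i) = tau (h i)) ->
  (forall y, y \notin codom h -> tau y = y) -> odd_perm tau = odd_perm sg.
Proof.
move=> hinj hE hfix; have [ts Ets dts] := prod_tpermP sg.
pose us := [seq (h t.1, h t.2) | t <- ts].
have dus : all dpair us.
  by rewrite all_map; apply: sub_all dts => t /=; rewrite /dpair /= (inj_eq hinj).
have -> : tau = (\prod_(t <- us) tperm t.1 t.2)%g.
  apply/permP => y; case: (boolP (y \in codom h)) => [/codomP[i ->]|yN].
    rewrite -hE Ets /us; elim: (ts) i => [|t ts' IH] i.
      by rewrite /= !big_nil !perm1.
    by rewrite /= !big_cons !permM IH inj_tperm.
  rewrite hfix // /us; elim: (ts) => [|t ts' IH]; first by rewrite big_nil perm1.
  rewrite /= big_cons permM /= tpermD //.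
    by apply: contraNneq yN => <-; exact: codom_f.
  by apply: contraNneq yN => <-; exact: codom_f.
by rewrite Ets !odd_perm_prod // size_map.
Qed.

(** A permutation of the values of [s] is transported through [h], the enumeration of the entries,
    to a permutation of positions with the same signature. *)
Lemma odd_inv_count_map n (s : seq 'I_n) (tau : 'S_n) :
  uniq s -> (forall y, y \notin s -> tau y = y) ->
  odd (inv_count (map val (map tau s))) = odd_perm tau (+) odd (inv_count (map val s)).
Proof.
move=> us fixs.
have stab y : y \in s -> tau y \in s.
  move=> ys; apply/negPn/negP => tN; move: (fixs _ tN) => /perm_inj E.
  by rewrite E ys in tN.
case: (posnP (size s)) => [/size0nil E|s0].
  rewrite E /=; have -> : tau = 1%g.
    by apply/permP => y; rewrite perm1 fixs // E.
  by rewrite odd_perm1.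
have x0 : 'I_n by case: (s) s0.
pose h (i : 'I_(size s)) := nth x0 s i.
have hinj : injective h by move=> i j /eqP; rewrite nth_uniq // => /eqP /val_inj.
have sgP (i : 'I_(size s)) : (index (tau (h i)) s < size s)%N.
  by rewrite index_mem stab // mem_nth.
pose sgf i := Ordinal (sgP i).
have sgE i : h (sgf i) = tau (h i) by rewrite /h /= nth_index // stab // mem_nth.
have sginj : injective sgf.
  by move=> i j E; apply: hinj; apply: (@perm_inj _ tau); rewrite -!sgE E.
rewrite (@odd_inv_count_perm (size s) (map val s) _ (perm sginj)) ?size_map //.
- rewrite (@odd_perm_equivariant _ _ h (perm sginj) tau) // => [i|y yN].
    by rewrite permE sgE.
  apply: fixs; apply: contra yN => /(nthP x0)[k ks <-].
  exact: (codom_f h (Ordinal ks)).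
- by rewrite (map_inj_uniq val_inj).
by move=> i; rewrite permE !(nth_map x0) ?size_map // -[nth x0 s (sgf i)]/(h _) sgE.
Qed.

End Signs.

(** * The exchange of entries in a Plücker relation *)

Section PositionSwap.
Variables (n : nat) (x0 : 'I_n) (J L : seq 'I_n) (k : nat) (rs : seq nat).
Hypotheses (uJ : uniq J) (uL : uniq L) (kJ : (k <= size J)%N).
Hypotheses (urs : uniq rs) (srs : size rs = k) (rsL : forall u, u \in rs -> (u < size L)%N).

Lemma nth_Jrep t : (t < size J)%N ->
  nth x0 (Jrep J L k rs) t = if (t < k)%N then nth x0 L (nth 0%N rs t) else nth x0 J t.
Proof.
move=> tJ; rewrite (nth_map (0%N, x0)) ?size_zip ?size_iota ?minnn //.
rewrite nth_zip ?size_iota // nth_iota //= add0n; case: ifP => // tk.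
by apply: set_nth_default; rewrite rsL // mem_nth // srs.
Qed.

Lemma nth_Lrep u : (u < size L)%N ->
  nth x0 (Lrep J L rs) u = if u \in rs then nth x0 J (index u rs) else nth x0 L u.
Proof.
move=> uL'; rewrite (nth_map (0%N, x0)) ?size_zip ?size_iota ?minnn //.
rewrite nth_zip ?size_iota // nth_iota //= add0n; case: ifP => // urs'.
by apply: set_nth_default; apply: leq_trans kJ; rewrite -srs index_mem.
Qed.

Let index_rs u : u \in rs -> (index u rs < k)%N.
Proof. by rewrite -index_mem srs. Qed.

Lemma mem_Lrep t : (t < k)%N -> nth x0 J t \in Lrep J L rs.
Proof.
move=> tk; have trs : nth 0%N rs t \in rs by rewrite mem_nth // srs.
have := nth_Lrep (rsL trs); rewrite trs index_uniq ?srs // => <-.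
by rewrite mem_nth // size_Lrep rsL.
Qed.

(* When [L] at the positions [rs] lists the first [k] entries of [J], the swap acts on values:
   it applies a permutation [tau] to [J] and its inverse to [L]. *)
Lemma swap_perm : (forall u, u \in rs -> nth x0 L u \in take k J) ->
  exists tau : 'S_n,
    [/\ map tau J = Jrep J L k rs, map tau (Lrep J L rs) = L &
        forall y, y \notin take k J -> tau y = y].
Proof.
move=> rsU; set U := take k J; pose V := [seq nth x0 L u | u <- rs].
have sU : size U = k by rewrite size_takel.
have uU : uniq U by rewrite take_uniq.
have sV : size V = k by rewrite size_map.
have uV : uniq V.
  rewrite map_inj_in_uniq // => a b /rsL aL /rsL bL /eqP.
  by rewrite nth_uniq // => /eqP.
have VU : V =i U.
  apply: (uniq_min_size uV _ _).2; last by rewrite sU sV.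
  by move=> _ /mapP[u urs' ->]; exact: rsU.
pose f x := if x \in U then nth x0 V (index x U) else x.
have fU x : x \in U -> f x \in U.
  by move=> xU; rewrite /f xU -VU mem_nth // sV -sU index_mem.
have finj : injective f.
  move=> x y; case: (boolP (x \in U)) (fU x) => xU Hx; case: (boolP (y \in U)) (fU y) => yU Hy.
  - rewrite /f xU yU => /eqP; rewrite nth_uniq ?sV -?sU ?index_mem //.
    by move=> /eqP E; rewrite -(nth_index x0 xU) E nth_index.
  - by move=> E; move: (Hx isT); rewrite E /f (negPf yU) (negPf yU).
  - by move=> E; move: (Hy isT); rewrite -E /f (negPf xU) (negPf xU).
  by rewrite /f (negPf xU) (negPf yU).
have fJ t : (t < k)%N -> f (nth x0 J t) = nth x0 L (nth 0%N rs t).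
  move=> tk; rewrite /f -(nth_take x0 tk) mem_nth ?sU // index_uniq ?sU //.
  by rewrite (nth_map 0%N) ?srs.
exists (perm finj); split.
- apply: (@eq_from_nth _ x0); rewrite size_map ?size_Jrep // => t tJ.
  rewrite (nth_map x0) // permE nth_Jrep //; case: ltnP => [/fJ //|kt].
  rewrite /f ifN //; move: uJ; rewrite -{1}(cat_take_drop k J) cat_uniq => /and3P[_ /hasPn H _].
  by apply: H; rewrite -(subnKC kt) -nth_drop mem_nth // size_drop ltn_sub2r // (leq_ltn_trans kt).
- apply: (@eq_from_nth _ x0); rewrite size_map size_Lrep // => u uL'.
  rewrite (nth_map x0) ?size_Lrep // permE nth_Lrep //; case: ifP => urs'.
    by rewrite fJ ?index_rs // nth_index.
  rewrite /f ifN // -VU; apply/mapP => -[w wrs /eqP]; rewrite nth_uniq ?(rsL wrs) //.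
  by move=> /eqP E; rewrite E wrs in urs'.
by move=> y yU; rewrite permE /f (negPf yU).
Qed.

End PositionSwap.

(** * Coordinate flags: Plücker relations and initial forms vanish there *)

Section CoordinateFlag.
Variables (n : nat) (o : seq 'I_n).
Hypotheses (uo : uniq o) (so : size o = n).

(** For [size s <= n] this says that [s] rearranges an initial segment of [o], that is, the Plücker
    coordinate of [s] is nonzero at the coordinate flag of [o]. *)
Definition flagseq (s : seq 'I_n) := uniq s && all (mem (take (size s) o)) s.

Lemma flagseq_mem s : (size s <= n)%N -> flagseq s -> s =i take (size s) o.
Proof.
move=> sn /andP[us /allP H]; apply: (uniq_min_size us _ _).2 => //.
by rewrite size_takel // so.
Qed.

Lemma sub_take_flag e d : (e <= d)%N -> {subset take e o <= take d o}.
Proof. by move=> ed x; rewrite -(take_takel o ed) => /mem_take. Qed.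

Section Swap.
Variables (J L : seq 'I_n) (k : nat) (rs : seq nat).
Hypotheses (uJ : uniq J) (uL : uniq L) (kJ : (k <= size J)%N).
Hypotheses (JL : (size J <= size L)%N) (Ln : (size L <= n)%N).
Hypotheses (urs : uniq rs) (srs : size rs = k) (rsL : forall u, u \in rs -> (u < size L)%N).
Variable x0 : 'I_n.

Local Notation J' := (Jrep J L k rs).
Local Notation L' := (Lrep J L rs).

(** Entries of [L] at [rs] occur in [J'], the others in [L'], so [L] lists an initial segment of
    [o]. An exchanged entry of [J] lies in [L'], hence in [L]; its position there belongs to [rs],
    since otherwise [L'] would repeat it, so it also occurs in [J']. *)
Lemma flagseq_unswap : flagseq J' -> flagseq L' -> flagseq J && flagseq L.
Proof.
rewrite {1}/flagseq size_Jrep => /andP[uJ' /allP HJ'].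
rewrite {1}/flagseq size_Lrep => /andP[uL' /allP HL'].
have index_rs u : u \in rs -> (index u rs < k)%N by rewrite -index_mem srs.
have HJt t : (t < size J)%N -> nth x0 J' t \in take (size J) o.
  by move=> tJ; apply: HJ'; rewrite mem_nth // size_Jrep.
have HLu u : (u < size L)%N -> nth x0 L' u \in take (size L) o.
  by move=> uL''; apply: HL'; rewrite mem_nth // size_Lrep.
have Lrs u : u \in rs -> nth x0 L u \in take (size J) o.
  move=> urs'; have tk := index_rs _ urs'; have tJ := leq_trans tk kJ.
  by have := HJt _ tJ; rewrite nth_Jrep // tk nth_index.
have fL : flagseq L.
  rewrite /flagseq uL; apply/(all_nthP x0) => u uL'' /=.
  case: (boolP (u \in rs)) => urs'; first exact: (sub_take_flag JL (Lrs _ urs')).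
  by have := HLu _ uL''; rewrite (nth_Lrep x0 kJ) // (negPf urs').
rewrite fL andbT /flagseq uJ; apply/(all_nthP x0) => t tJ /=.
case: (ltnP t k) => tk; last by have := HJt _ tJ; rewrite nth_Jrep // ltnNge tk.
have trs : nth 0%N rs t \in rs by rewrite mem_nth // srs.
have Et : nth x0 L' (nth 0%N rs t) = nth x0 J t.
  by rewrite (nth_Lrep x0 kJ) ?rsL // trs index_uniq // srs.
have : nth x0 J t \in L by rewrite flagseq_mem // -Et; apply: HLu; exact: rsL.
case/(nthP x0) => u uL'' Eu; case: (boolP (u \in rs)) => urs'; first by rewrite -Eu Lrs.
have Eu' : nth x0 L' u = nth x0 L' (nth 0%N rs t).
  by rewrite Et -Eu (nth_Lrep x0 kJ) // (negPf urs').
move/eqP: Eu'; rewrite nth_uniq ?size_Lrep ?(rsL trs) // => /eqP E.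
by rewrite E trs in urs'.
Qed.

(** [J] and [J'] list the same set, so the incoming entry belongs to [J]; it is not one of the
    entries that [J'] keeps, as [J'] has no repetition. Hence at most one choice of [rs] gives a
    nonzero term. *)
Lemma flagseq_swap_positions u :
  flagseq J -> flagseq J' -> u \in rs -> nth x0 L u \in take k J.
Proof.
move=> fJ fJ' urs'; have tk : (index u rs < k)%N by rewrite -srs index_mem.
have tJ := leq_trans tk kJ.
have Jn := leq_trans JL Ln.
have Et : nth x0 J' (index u rs) = nth x0 L u by rewrite nth_Jrep // tk nth_index.
have : nth x0 L u \in J.
  by rewrite (flagseq_mem Jn fJ) -(size_Jrep J L k rs) -flagseq_mem ?size_Jrep // -Et mem_nth ?size_Jrep.
case/(nthP x0) => t' t'J Et'; case: (ltnP t' k) => t'k.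
  by rewrite -Et' -(nth_take x0 t'k) mem_nth // size_takel.
have : nth x0 J' t' = nth x0 J' (index u rs).
  by rewrite nth_Jrep // ltnNge t'k /= Et' Et.
case/andP: fJ' => uJ' _ /eqP; rewrite nth_uniq ?size_Jrep // => /eqP E.
by rewrite -E ltnNge t'k in tk.
Qed.

(** The exchange applies [tau] to [J] and its inverse to [L], so the two signatures cancel. *)
Lemma flagseq_swap : flagseq J -> flagseq L ->
  (forall u, u \in rs -> nth x0 L u \in take k J) ->
  [/\ flagseq J', flagseq L' &
    odd (inv_count (map val J') + inv_count (map val L')) =
    odd (inv_count (map val J) + inv_count (map val L))].
Proof.
move=> fJ fL rsU; have Jn := leq_trans JL Ln.
have [tau [EJ EL Hfix]] := swap_perm uJ uL kJ urs srs rsL rsU.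
have uJ' : uniq J' by rewrite -EJ (map_inj_uniq (@perm_inj _ _)).
have uL' : uniq L' by rewrite -(map_inj_uniq (@perm_inj _ tau)) EL.
split.
- rewrite /flagseq uJ' size_Jrep; apply/(all_nthP x0) => t; rewrite size_Jrep => tJ /=.
  rewrite nth_Jrep // -flagseq_mem //; case: ltnP => tk; last exact: mem_nth.
  by apply: (@mem_take k); apply: rsU; rewrite mem_nth // srs.
- rewrite /flagseq uL' size_Lrep; apply/(all_nthP x0) => u; rewrite size_Lrep => uL'' /=.
  rewrite (nth_Lrep x0 kJ) //; case: ifP => urs'; last by rewrite -flagseq_mem // mem_nth.
  apply: (sub_take_flag JL); rewrite -flagseq_mem // mem_nth //.
  by apply: leq_trans kJ; rewrite -srs index_mem.
have fixJ y : y \notin J -> tau y = y.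
  by move=> yJ; apply: Hfix; apply: contra yJ => /mem_take.
have fixL y : y \notin L' -> tau y = y.
  move=> yL; apply: Hfix; apply: contra yL => /(nthP x0)[t].
  rewrite size_takel // => tk <-; rewrite nth_take //.
  exact: (mem_Lrep x0 kJ urs srs rsL tk).
have := odd_inv_count_map uJ fixJ; rewrite EJ => E1.
have := odd_inv_count_map uL' fixL; rewrite EL => E2.
by rewrite !oddD E1 E2; case: (odd_perm tau); case: (odd _); case: (odd _).
Qed.

End Swap.

Variable C : idomainType.

(** The Plücker coordinates of the flag spanned by the initial segments of [o], scaled so that the
    nonzero coordinate of each block is 1. *)
Definition flagpt (S : PT n) : C := (val S == [set x in take #|val S| o])%:R.

Lemma flagpt_neq0 S : (flagpt S != 0) = (val S == [set x in take #|val S| o]).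
Proof. by rewrite /flagpt; case: (val S == _); rewrite ?oner_eq0 ?eqxx. Qed.

Lemma evalp_pseq_flagpt s : (0 < size s < n)%N ->
  evalp (pseq C s) flagpt = if flagseq s then (-1) ^+ inv_count (map val s) else 0.
Proof.
move=> sn; rewrite /pseq /flagseq /evalp; case: (boolP (uniq s)) => us /=; last exact: meval0.
have cs : #|[set x in s]| = size s by rewrite cardsE (card_uniqP us).
case: insubP => [P _ EP|]; last by rewrite cs sn.
rewrite mevalZ mevalXU enum_rankK /flagpt EP cs.
have -> : ([set x in s] == [set x in take (size s) o]) = all (mem (take (size s) o)) s.
  apply/eqP/allP => [E x xs|H]; first by move/setP/(_ x): E; rewrite !inE xs => /esym.
  apply/setP => x; rewrite !inE (@flagseq_mem s) ?(ltnW (proj2 (andP sn))) //.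
  by rewrite /flagseq us; apply/allP.
by case: ifP; rewrite ?mulr1 ?mulr0.
Qed.

(** If the leading product vanishes at the flag, so does every exchanged term, by [flagseq_unswap].
    Otherwise exactly one exchanged term survives, and it has the same sign. *)
Lemma evalp_plucker_flagpt (J L : seq 'I_n) k : uniq J -> uniq L ->
  (1 <= size J <= size L)%N -> (size L <= n - 1)%N -> (1 <= k <= size J)%N ->
  evalp (plucker_rel C J L k) flagpt = 0.
Proof.
move=> uJ uL /andP[J0 JL] Ln1 /andP[k0 kJ].
have n0 : (0 < n)%N by lia.
have Ln : (size L < n)%N by lia.
have x0 := Ordinal n0.
rewrite /plucker_rel /evalp mevalB mevalM [X in _ - X]raddf_sum /=.
rewrite -/(evalp (pseq C J) flagpt) -/(evalp (pseq C L) flagpt).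
pose rs_ (R : {set 'I_(size L)}) := sort leq (map val (enum R)).
have mrs R (u : 'I_(size L)) : (val u \in rs_ R) = (u \in R).
  by rewrite mem_sort (mem_map val_inj) mem_enum.
have urs R : uniq (rs_ R) by rewrite sort_uniq (map_inj_uniq val_inj) enum_uniq.
have srs (R : {set 'I_(size L)}) : #|R| == k -> size (rs_ R) = k.
  by move=> /eqP <-; rewrite size_sort size_map -cardE.
have rsL R u : u \in rs_ R -> (u < size L)%N.
  by rewrite mem_sort => /mapP[w _ ->]; exact: ltn_ord.
have EJ R : evalp (pseq C (Jrep J L k (rs_ R))) flagpt =
    if flagseq (Jrep J L k (rs_ R)) then (-1) ^+ inv_count (map val (Jrep J L k (rs_ R))) else 0.
  by rewrite evalp_pseq_flagpt // size_Jrep; lia.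
have EL R : evalp (pseq C (Lrep J L (rs_ R))) flagpt =
    if flagseq (Lrep J L (rs_ R)) then (-1) ^+ inv_count (map val (Lrep J L (rs_ R))) else 0.
  by rewrite evalp_pseq_flagpt // size_Lrep; lia.
rewrite (eq_bigr (fun R => evalp (pseq C (Jrep J L k (rs_ R))) flagpt *
                           evalp (pseq C (Lrep J L (rs_ R))) flagpt)); last first.
  by move=> R _; rewrite -mevalM.
rewrite !evalp_pseq_flagpt ?J0 ?(leq_trans J0 JL) //=; last by lia.
case: (boolP (flagseq J && flagseq L)) => [/andP[fJ fL]|Nf]; last first.
  rewrite big1 ?subr0 => [|R Rk].
    by case: (flagseq J) Nf => /= [/negPf ->|_]; rewrite ?mulr0 ?mul0r.
  rewrite EJ EL; case: ifP => fJ'; last by rewrite mul0r.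
  case: ifP => fL'; last by rewrite mulr0.
  by move: Nf; rewrite (flagseq_unswap uJ uL kJ JL (ltnW Ln) (urs R) (srs R Rk) (@rsL R) x0 fJ' fL').
(* The surviving term exchanges the first [k] entries of [J] with their own occurrences in [L]; they
   do occur there because the segment listed by [J] is contained in the one listed by [L]. *)
pose R0 : {set 'I_(size L)} := [set u : 'I_(size L) | nth x0 L u \in take k J].
have R0k : #|R0| == k.
  have inj : injective (fun u : 'I_(size L) => nth x0 L u).
    by move=> a b /eqP; rewrite nth_uniq // => /eqP /val_inj.
  rewrite -(card_imset _ inj); have -> : (fun u : 'I_(size L) => nth x0 L u) @: R0 = [set x in take k J].
    apply/setP => x; rewrite inE; apply/imsetP/idP => [[u]|xU]; first by rewrite inE => H ->.
    have : x \in L.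
      rewrite (flagseq_mem (ltnW Ln) fL); apply: (sub_take_flag JL).
      rewrite -flagseq_mem ?(mem_take xU) //; lia.
    by case/(nthP x0) => u uL' Eu; exists (Ordinal uL'); rewrite ?inE /= Eu.
  by rewrite cardsE (card_uniqP _) ?take_uniq // size_takel.
rewrite (bigD1 R0) //= [X in _ - (_ + X)]big1 ?addr0 => [|R /andP[Rk RR0]]; last first.
  rewrite EJ; case: ifP => fJ'; last by rewrite mul0r.
  case/negP: RR0; rewrite eqEcard (eqP Rk) (eqP R0k) leqnn andbT; apply/subsetP => u uR.
  rewrite inE; apply: (flagseq_swap_positions kJ JL (ltnW Ln) (srs R Rk) (@rsL R) x0 fJ fJ').
  by rewrite mrs.
have [|fJ' fL' E] := flagseq_swap uJ uL kJ JL (ltnW Ln) (urs R0) (srs R0 R0k) (@rsL R0) (x0:=x0) fJ fL.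
  by move=> u urs'; move: (urs'); rewrite -[u]/(val (Ordinal (rsL _ _ urs'))) mrs inE.
rewrite EJ EL fJ fL fJ' fL'; apply/eqP; rewrite subr_eq0; apply/eqP.
by rewrite -!exprD -signr_odd -[RHS]signr_odd E.
Qed.

Lemma admissible_flagpt : admissible flagpt.
Proof.
move=> k kn; have ck : #|[set x in take k o]| = k.
  by rewrite cardsE (card_uniqP _) ?take_uniq // size_takel // so; lia.
have PS : (0 < #|[set x in take k o]| < n)%N by rewrite ck.
exists (Sub [set x in take k o] PS : PT n).
by rewrite flagpt_neq0 !SubK ck.
Qed.

(* A coordinate flag lies on exactly one monomial of each multidegree, so a multihomogeneous
   polynomial vanishing there has no monomial that is nonzero there. *)
Lemma evalp_inw_flagpt (f : An C n) : multihomog f -> evalp f flagpt = 0 ->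
  evalp (inw f) flagpt = 0.
Proof.
move=> [d hd]; pose mv (m : 'X_{1.. Nv n}) : C := \prod_i flagpt (enum_val i) ^+ m i.
have mvP m : mv m != 0 -> forall x, flagpt (enum_val x) = 0 -> m x = 0%N.
  rewrite /mv => /prodf_neq0 H x Ex; apply/eqP; move: (H x isT); rewrite Ex expr0n.
  by case: (m x == 0%N); rewrite //= eqxx.
(* Each block has a single coordinate that is nonzero at the flag, so it carries the whole degree of
   the monomial in that block. *)
have mvE m x : mv m != 0 -> flagpt (enum_val x) != 0 -> m x = blockdeg m #|val (enum_val x)|.
  move=> Hm Hx; rewrite /blockdeg (bigD1 x) //= big1 ?addn0 // => y /andP[/eqP Ey yx].
  apply: mvP => //; apply/eqP; apply: contraNT yx; rewrite flagpt_neq0 => /eqP E1.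
  move: Hx; rewrite flagpt_neq0 => /eqP E2.
  by apply/eqP/enum_val_inj/val_inj; rewrite E1 E2 Ey.
have muniq m1 m2 : m1 \in msupp f -> m2 \in msupp f -> mv m1 != 0 -> mv m2 != 0 -> m1 = m2.
  move=> /hd d1 /hd d2 v1 v2; apply/mnmP => x.
  have [E|E] := eqVneq (flagpt (enum_val x)) 0; first by rewrite !mvP.
  by rewrite !mvE // d1 d2.
rewrite /evalp !mevalE => Ef.
have all0 m : m \in msupp f -> mv m = 0.
  move=> mf; apply/eqP/negPn/negP => Hm; move/eqP: Ef.
  rewrite (bigD1_seq m) ?msupp_uniq //= [X in _ + X]big_seq_cond [X in _ + X]big1 ?addr0.
    by rewrite mulf_eq0 -/(mv m) (negPf Hm) orbF mcoeff_eq0 mf.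
  move=> m' /andP[m'f m'm]; rewrite -/(mv m'); have [->|Hm'] := eqVneq (mv m') 0.
    by rewrite mulr0.
  by rewrite (muniq m' m) ?eqxx in m'm.
rewrite big_seq big1 // => m; rewrite [inw f]/(mproj _ f) msupp_mproj => /andP[_ mf].
by rewrite -/(mv m) all0 // mulr0.
Qed.

(** The hypothesis makes every coordinate generator of the Schubert ideal vanish at the flag; with
    the Plücker relations the whole ideal vanishes, and [evalp_inw_flagpt] passes to initial
    forms. *)
Lemma degSchubert_flagpt (v : 'S_n) :
  (forall k, (0 < k < n)%N -> subset_le [set x in take k o] (vset v k)) ->
  degSchubert v flagpt.
Proof.
move=> H; apply/degSchubert_homogP; split; first exact: admissible_flagpt.
move=> f hf [s [sG Ef]]; apply: evalp_inw_flagpt => //.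
rewrite Ef /evalp raddf_sum /= big_seq big1 // => -[g h] /sG /= Gh.
rewrite mevalM -/(evalp h flagpt) (_ : evalp h _ = 0) ?mulr0 //.
case: Gh => [[J [L [k [/andP[uJ uL] JL Ln kJ ->]]]]|[S [NS ->]]].
  exact: evalp_plucker_flagpt.
rewrite /evalp mevalXU enum_rankK /flagpt; case: eqP => // E.
by move: NS; rewrite {1}E H // (valP S).
Qed.

End CoordinateFlag.

(** * Three-term relations and their initial forms modulo one coordinate *)

Section ThreeTerm.
Variables (C : idomainType) (n : nat).

(** Exchanging [z] with an entry of [X] would repeat that entry in the smaller sequence, so only the
    exchanges with [q] and [r] remain. *)
Lemma plucker_three_term (z q r : 'I_n) (X : seq 'I_n) : uniq [:: z, q, r & X] ->
  plucker_rel C (z :: X) [:: q, r & X] 1 =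
  pseq C (z :: X) * pseq C [:: q, r & X]
  - (pseq C (q :: X) * pseq C [:: z, r & X] + pseq C (r :: X) * pseq C [:: q, z & X]).
Proof.
move=> uX; rewrite /plucker_rel; congr (_ - _).
have rs1 (u : 'I_(size [:: q, r & X])) : sort leq (map val (enum [set u])) = [:: val u].
  by rewrite enum_set1.
have EJ (u : 'I_(size [:: q, r & X])) :
    Jrep (z :: X) [:: q, r & X] 1 [:: val u] = nth z [:: q, r & X] u :: X.
  apply: (@eq_from_nth _ z); rewrite size_Jrep // => t tX.
  rewrite nth_Jrep //; first by case: t tX.
  by move=> w; rewrite inE => /eqP ->; exact: ltn_ord.
have EL (u : 'I_(size [:: q, r & X])) t : (t < size [:: q, r & X])%N ->
    nth z (Lrep (z :: X) [:: q, r & X] [:: val u]) t =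
    if t == u :> nat then z else nth z [:: q, r & X] t.
  move=> tX; rewrite (@nth_Lrep _ z (z :: X) _ 1) // inE.
  by case: eqP => // ->; rewrite /= eqxx.
pose u0 : 'I_(size [:: q, r & X]) := ord0.
pose u1 : 'I_(size [:: q, r & X]) := @Ordinal (size X).+2 1 isT.
have u01 : [set u1] != [set u0] by rewrite (inj_eq set1_inj).
rewrite (bigD1 [set u0]) ?cards1 //= (bigD1 [set u1]) ?cards1 ?eqxx //=.
rewrite big1 => [|R /andP[/andP[/cards1P[u ->] R0] R1]].
  rewrite addr0 !rs1 !EJ /=; congr (_ * pseq C _ + _ * pseq C _).
    by apply: (@eq_from_nth _ z); rewrite size_Lrep // => t tX; rewrite (EL u0) //; case: t tX.
  by apply: (@eq_from_nth _ z); rewrite size_Lrep // => t tX; rewrite (EL u1) //; case: t tX => [|[]].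
rewrite rs1 EJ {1}/pseq ifN ?mul0r // cons_uniq negb_and negbK.
case: u R0 R1 => -[|[|u]] uX' //; rewrite ?(inj_eq set1_inj) //= => _ _.
by rewrite mem_nth.
Qed.

Lemma pseq_pvar (s : seq 'I_n) (S : PT n) : uniq s -> val S = [set x in s] ->
  pseq C s = (-1) ^+ inv_count (map val s) *: pvar C S.
Proof. by move=> us ES; rewrite /pseq us -ES valK. Qed.

Lemma PT_of_seq (s : seq 'I_n) : uniq s -> (0 < size s < n)%N ->
  exists S : PT n, val S = [set x in s].
Proof.
move=> us sn; have PS : (0 < #|[set x in s]| < n)%N by rewrite cardsE (card_uniqP us).
by exists (Sub [set x in s] PS).
Qed.

Lemma wI_count (s : seq 'I_n) (S : PT n) : uniq s -> val S = [set x in s] ->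
  wI S = count (fun a : 'I_n => (size s <= a.+1 <= n - 1)%N) s.
Proof.
move=> us ES; rewrite /wI ES [#|[set x in s]|]cardsE (card_uniqP us).
rewrite -size_filter -(card_uniqP (filter_uniq _ us)) cardsE.
by apply: eq_card => a; rewrite mem_filter unfold_in /= inE andbC.
Qed.

Lemma mwt_pair (A B : PT n) : mwt (U_(enum_rank A) + U_(enum_rank B))%MM = (wI A + wI B)%N.
Proof.
have mwtU (S : PT n) : (\sum_x U_(enum_rank S)%MM x * wI (enum_val x))%N = wI S.
  rewrite (bigD1 (enum_rank S)) //= mnm1E eqxx mul1n enum_rankK big1 ?addn0 // => x xS.
  by rewrite mnm1E eq_sym (negPf xS).
rewrite /mwt -[wI A]mwtU -[wI B]mwtU -big_split.
by apply: eq_bigr => x _; rewrite mnmDE mulnDl.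
Qed.

Lemma inw_binomial (a b : C) (m1 m2 : 'X_{1.. Nv n}) : a != 0 -> (mwt m1 < mwt m2)%N ->
  inw (a *: 'X_[m1] + b *: 'X_[m2] : An C n) = a *: 'X_[m1].
Proof.
move=> a0 lt12; set f := _ + _.
have cf m : f@_m = a * (m1 == m)%:R + b * (m2 == m)%:R by rewrite mcoeffD !mcoeffZ !mcoeffX.
have m21 : (m2 == m1) = false by apply: contraTF lt12 => /eqP ->; rewrite ltnn.
have m1f : m1 \in msupp f by rewrite mcoeff_msupp cf eqxx m21 mulr1 mulr0 addr0.
have Emin : minwt f = mwt m1.
  apply: minwt_eq => // m; rewrite mcoeff_msupp cf.
  have [<- //|_] := eqVneq m1 m; have [<- _|_] := eqVneq m2 m; first exact: ltnW.
  by rewrite !mulr0 addr0 eqxx.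
apply/mpolyP => m; rewrite [inw f]/(mproj _ f) mcoeff_mproj Emin cf mcoeffZ mcoeffX.
have [<-|_] := eqVneq m1 m; first by rewrite eqxx m21 mulr0 addr0.
have [<-|_] := eqVneq m2 m; first by rewrite (gtn_eqF lt12) mulr0.
by rewrite !mulr0 addr0 if_same.
Qed.

(* The special label [z] has weight 1 in sets of size [(size X).+1] and 0 in sets of size
   [(size X).+2], hence the term with [z] in the smaller set is the only one not of minimal weight;
   one of the remaining two is killed by [p_T]. *)
Lemma degSchubert_mul0 (v : 'S_n) (z q r : 'I_n) (X : seq 'I_n) (A B T : PT n) (x : PT n -> C) :
  uniq [:: z, q, r & X] -> val z = size X -> ((size X).+2 < n)%N ->
  val A = [set y in r :: X] -> val B = [set y in [:: q, z & X]] ->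
  ~~ subset_le (val T) (vset v #|val T|) ->
  val T = [set y in q :: X] \/ val T = [set y in [:: z, r & X]] ->
  degSchubert v x -> x A * x B = 0.
Proof.
move=> uzqrX Ez Xn EA EB NT ET [_ Hx].
move: (uzqrX) => /=; rewrite !inE !negb_or -!andbA => /and5P[zq zr zX qr /and3P[qX rX uX]].
have uA : uniq (r :: X) by rewrite /= rX.
have uB : uniq [:: q, z & X] by rewrite /= inE negb_or eq_sym zq qX zX.
have uA' : uniq (z :: X) by rewrite /= zX.
have uB' : uniq [:: q, r & X] by rewrite /= inE negb_or qr qX rX.
have uP : uniq (q :: X) by rewrite /= qX.
have uQ : uniq [:: z, r & X] by rewrite /= inE negb_or zr zX rX.
have [A' EA'] : exists S : PT n, val S = [set y in z :: X].
  by apply: PT_of_seq => //=; rewrite ltnW.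
have [B' EB'] : exists S : PT n, val S = [set y in [:: q, r & X]].
  exact: PT_of_seq.
(* [X] and [q] contribute equally to both sides. So does [r], whose contribution could change only
   for [r = size X], which is the value of [z]. Only [z] makes a difference, counting in [A'] but
   not in [B]. *)
have lt_wt : (wI A + wI B < wI A' + wI B')%N.
  rewrite (wI_count uA EA) (wI_count uB EB) (wI_count uA' EA') (wI_count uB' EB') /=.
  have : (r : nat) != size X by rewrite -Ez eq_sym.
  move: Xn; rewrite Ez; move: (count _ X) (count _ X) => c1 c2; clear; lia.
have [g Eg] : exists g, pseq C (q :: X) * pseq C [:: z, r & X] = g * pvar C T.
  case: ET => ET; rewrite (pseq_pvar _ ET) //.
    by rewrite -scalerAl mulrC scalerAl; eexists.
  by rewrite -scalerAr scalerAl; eexists.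
(* Minus the three-term relation, with the multiple [g] of [p_T] removed. *)
pose f := pseq C (r :: X) * pseq C [:: q, z & X] - pseq C (z :: X) * pseq C [:: q, r & X].
have If : in_ideal (@SchGen C n v) f.
  exists [:: (-1, plucker_rel C (z :: X) [:: q, r & X] 1); (- g, pvar C T)]; split.
    move=> y; rewrite !inE => /orP[] /eqP -> /=; last by right; exists T.
    left; exists (z :: X), [:: q, r & X], 1%N; split=> //; first by rewrite uA' uB'.
      by rewrite /= leqnSn.
    by rewrite /=; clear -Xn; lia.
  rewrite big_cons big_seq1 plucker_three_term //= mulN1r mulNr -Eg opprB /f.
  by rewrite [RHS]addrAC [X in _ = X - _ - _]addrC addrK.
have Ef : f = ((-1) ^+ inv_count (map val (r :: X)) * (-1) ^+ inv_count (map val [:: q, z & X]))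
      *: 'X_[U_(enum_rank A) + U_(enum_rank B)] +
    (- ((-1) ^+ inv_count (map val (z :: X)) * (-1) ^+ inv_count (map val [:: q, r & X])))
      *: 'X_[U_(enum_rank A') + U_(enum_rank B')].
  rewrite /f (pseq_pvar uA EA) (pseq_pvar uB EB) (pseq_pvar uA' EA') (pseq_pvar uB' EB').
  by rewrite !mpolyXD scaleNr -!scalerAl -!scalerAr !scalerA.
have : evalp (inw f) x = 0.
  apply: Hx; exists [:: (1, inw f)]; split; last by rewrite big_seq1 mul1r.
  by move=> y; rewrite inE => /eqP -> /=; exists f.
rewrite Ef inw_binomial ?mwt_pair //; last by rewrite mulf_neq0 ?signr_eq0.
rewrite /evalp mevalZ mpolyXD mevalM !mevalXU !enum_rankK => /eqP.
by rewrite mulf_eq0 mulf_eq0 !signr_eq0 => /eqP.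
Qed.

End ThreeTerm.

(** * Increasing enumerations of subsets *)

Section SortedSubsets.
Variable n : nat.
Implicit Types S K : {set 'I_n}.

Definition sorted_vals S : seq nat := sort leq (map val (enum S)).

Lemma sorted_vals_ltn S : sorted ltn (sorted_vals S).
Proof.
rewrite ltn_sorted_uniq_leq sort_uniq (map_inj_uniq val_inj) enum_uniq /=.
exact: (sort_sorted leq_total).
Qed.

Lemma mem_sorted_vals S (y : 'I_n) : (val y \in sorted_vals S) = (y \in S).
Proof. by rewrite mem_sort (mem_map val_inj) mem_enum. Qed.

Lemma sorted_vals_bound S y : y \in sorted_vals S -> (y < n)%N.
Proof. by rewrite mem_sort => /mapP[w _ ->]; exact: ltn_ord. Qed.

Lemma size_sorted_vals S : size (sorted_vals S) = #|S|.
Proof. by rewrite size_sort size_map -cardE. Qed.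

Lemma sorted_vals_eq S t : sorted ltn t -> (forall y, y \in t -> (y < n)%N) ->
  (forall y : 'I_n, (val y \in t) = (y \in S)) -> sorted_vals S = t.
Proof.
move=> st tn E; apply: (irr_sorted_eq ltn_trans ltnn) => // [|y].
  exact: sorted_vals_ltn.
case: (ltnP y n) => [yn|ny].
  by rewrite -[y]/(val (Ordinal yn)) mem_sorted_vals E.
have [|yt] := boolP (y \in t); first by move/tn; rewrite ltnNge ny.
by apply/negP => /sorted_vals_bound; rewrite ltnNge ny.
Qed.

(** The [size s - r] entries from position [r] on are distinct, at least the first of them, and
    below [m]. *)
Lemma sorted_ltn_nth_le (s : seq nat) m r : sorted ltn s -> (forall y, y \in s -> (y < m)%N) ->
  (r < size s)%N -> (nth 0 s r + (size s - r) <= m)%N.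
Proof.
elim: s r => // a s IH [|r] /= ps sm rs; last first.
  rewrite subSS; apply: IH => //; first exact: path_sorted ps.
  by move=> y ys; apply: sm; rewrite inE ys orbT.
case: s ps sm IH {rs} => [|b s] ps sm IH; first by rewrite /= addn1 sm ?mem_head.
have := IH 0%N (path_sorted ps) _ isT; move: ps => /= /andP[ab _] H.
have := H (fun y ys => sm y (mem_behead (s := [:: a, b & s]) ys)); lia.
Qed.

Lemma all2_leq_nth (s t : seq nat) : size s = size t ->
  (forall r, (r < size s)%N -> (nth 0 s r <= nth 0 t r)%N) ->
  all2 (fun a b => a <= b)%N s t.
Proof.
elim: s t => [|a s IH] [|b t] //= [Est] H; rewrite (H 0%N) //=.
by apply: IH => // r rs; exact: (H r.+1).
Qed.

End SortedSubsets.

(** * The Schubert divisor of [w] and its coordinate flags *)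

Section Divisor.
Variables (n : nat) (i : 'I_n) (w : 'S_n).
Hypotheses (i0 : (0 < i)%N) (wE : forall a : 'I_n, w (sref i a) = w0 n a).

Lemma val_sref (a : 'I_n) :
  val (sref i a) = if a == i.-1 :> nat then val i else if a == i :> nat then i.-1 else val a.
Proof.
rewrite /sref; case: tpermP => [->|->|/eqP a1 /eqP a2]; rewrite ?eqxx //=.
  by case: eqP => //; lia.
by rewrite -!val_eqE /= in a1 a2; rewrite (negPf a1) (negPf a2).
Qed.

Lemma mem_vset (y : 'I_n) k : (y \in vset w k) = (sref i (rev_ord y) < k)%N.
Proof.
have {1}-> : y = w (sref i (rev_ord y)) by rewrite wE permE rev_ordK.
by rewrite (mem_imset _ _ perm_inj) inE.
Qed.

(** For [k <> i] the reflection preserves the first [k] labels, so [w] and [w0] have the same image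
    of them. *)
Lemma sorted_vals_vset k : (0 < k < n)%N -> k <> i -> sorted_vals (vset w k) = iota (n - k) k.
Proof.
move=> kn ki; apply: sorted_vals_eq; first exact: iota_ltn_sorted.
  by move=> y; rewrite mem_iota; lia.
move=> y; rewrite mem_vset mem_iota val_sref /=; have := ltn_ord y; do 2?[case: eqP => ?]; lia.
Qed.

(** Here the reflection replaces label [i] by [i + 1] before [w0] reverses the order, so the least
    of the top [i] labels drops by one. *)
Lemma sorted_vals_vset_i :
  sorted_vals (vset w i) = (n - i.+1)%N :: iota (n - i).+1 i.-1.
Proof.
have := ltn_ord i => ilt; apply: sorted_vals_eq.
- rewrite /= path_sortedE; last exact: ltn_trans.
  rewrite iota_ltn_sorted andbT; apply/allP => y; rewrite mem_iota; lia.
- by move=> y; rewrite inE mem_iota; lia.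
move=> y; rewrite mem_vset inE mem_iota val_sref /=; have := ltn_ord y.
by case: (_ =P i.-1) => ?; [|case: (_ =P nat_of_ord i) => ?]; lia.
Qed.

(** The top [k]-set dominates every [k]-set. In size [i] the bound differs from the top set only in
    its least entry, and [z] bounds the least entry of [S]. *)
Lemma subset_le_vset k (S : {set 'I_n}) : (0 < k < n)%N -> #|S| = k ->
  (k = i -> exists2 z, z \in S & (z < n - i)%N) -> subset_le S (vset w k).
Proof.
move=> kn Sk Hi; rewrite /subset_le -![sort _ _]/(sorted_vals _).
have ub r : (r < k)%N -> (nth 0 (sorted_vals S) r + (k - r) <= n)%N.
  move=> rk; have := @sorted_ltn_nth_le (sorted_vals S) n r (sorted_vals_ltn S).
  by rewrite size_sorted_vals Sk; apply => // y; exact: sorted_vals_bound.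
case: (eqVneq k i) => [Ek|/eqP ki]; last first.
  rewrite sorted_vals_vset //; apply: all2_leq_nth; rewrite size_sorted_vals Sk ?size_iota //.
  by move=> r rk; rewrite nth_iota //; have := ub r rk; lia.
have [z zS zi] := Hi Ek; rewrite Ek sorted_vals_vset_i.
have ilt := ltn_ord i.
apply: all2_leq_nth; rewrite size_sorted_vals Sk /= ?size_iota; first by lia.
case=> [_|r rk] /=; last by rewrite nth_iota; have := ub r.+1 rk; lia.
move: zS; rewrite -mem_sorted_vals; have := sorted_vals_ltn S.
case: (sorted_vals S) => //= a s; rewrite path_sortedE; last exact: ltn_trans.
move=> /andP[/allP H _]; rewrite inE => /predU1P[|/H]; move: zi => /=; lia.
Qed.

Lemma not_subset_le_top (T : {set 'I_n}) : (forall y : 'I_n, (y \in T) = (n - i <= y)%N) ->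
  ~~ subset_le T (vset w i).
Proof.
move=> ET; have ilt := ltn_ord i.
have E : sorted_vals T = iota (n - i) i.
  apply: sorted_vals_eq; first exact: iota_ltn_sorted.
    by move=> y; rewrite mem_iota; lia.
  by move=> y; rewrite ET mem_iota /=; have := ltn_ord y; lia.
rewrite /subset_le -![sort _ _]/(sorted_vals _) E sorted_vals_vset_i.
rewrite -{2}(prednK i0) /= negb_and; apply/orP; left; lia.
Qed.

(** Complete [s] to an ordering [o] of all labels. By [subset_le_vset] only block [i] restricts the
    coordinate flags in the divisor, and [z] takes care of it. *)
Lemma exists_flagpt (C : idomainType) (s : seq 'I_n) (S : PT n) (z : 'I_n) :
  uniq s -> (i <= size s)%N -> z \in take i s -> (z < n - i)%N ->
  (#|val S| <= size s)%N -> val S = [set x in take #|val S| s] ->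
  exists x : PT n -> C, degSchubert w x /\ x S != 0.
Proof.
move=> us si zs zn Ss ES; pose o := s ++ [seq y <- enum 'I_n | y \notin s].
have uo : uniq o.
  rewrite cat_uniq us filter_uniq ?enum_uniq // andbT.
  by apply/hasPn => y; rewrite mem_filter => /andP[].
have so : size o = n.
  rewrite -(card_uniqP uo) -[RHS]card_ord; apply: eq_card => y.
  by rewrite mem_cat mem_filter mem_enum andbT orbN.
exists (@flagpt n o C); split; last by rewrite flagpt_neq0 takel_cat // -ES.
apply: degSchubert_flagpt => // k kn; apply: subset_le_vset => //.
  by rewrite cardsE (card_uniqP _) ?take_uniq // size_takel // so; lia.
by move=> ->; exists z => //; rewrite inE takel_cat.
Qed.

Lemma reducible_of_three_term (C : idomainType) (T : {set 'I_n}) (z q r : 'I_n) (X : seq 'I_n) :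
  (forall y : 'I_n, (y \in T) = (n - i <= y)%N) -> #|T| = i ->
  uniq [:: z, q, r & X] -> val z = size X -> ((size X).+2 < n)%N ->
  (T = [set y in q :: X] /\ (z < n - i)%N /\ (r < n - i)%N) \/
  (T = [set y in [:: z, r & X]] /\ (q < n - i)%N) ->
  reducible (@degSchubert C n w).
Proof.
move=> ET Ti uzqrX Ez Xn HT.
have ilt := ltn_ord i.
move: (uzqrX) => /=; rewrite !inE !negb_or -!andbA => /and5P[zq zr zX qr /and3P[qX rX uX]].
have uA : uniq (r :: X) by rewrite /= rX.
have uB : uniq [:: z, q & X] by rewrite /= inE negb_or zq qX zX.
have [A EA] : exists S : PT n, val S = [set y in r :: X].
  by apply: PT_of_seq => //=; rewrite ltnW.
have [B EB] : exists S : PT n, val S = [set y in [:: z, q & X]].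
  exact: PT_of_seq.
have PT' : (0 < #|T| < n)%N by rewrite Ti i0.
have cA : #|val A| = (size X).+1 by rewrite EA cardsE (card_uniqP uA).
have cB : #|val B| = (size X).+2 by rewrite EB cardsE (card_uniqP uB).
have sizeT s : uniq s -> T = [set y in s] -> size s = i.
  by move=> us E; rewrite -Ti E cardsE (card_uniqP us).
apply: (@reducible_degSchubert _ _ _ A B).
- move=> x; apply: (@degSchubert_mul0 _ _ w z q r X A B (Sub T PT')) => //.
  + by rewrite EB; apply/setP => y; rewrite !inE orbCA.
  + by rewrite SubK Ti not_subset_le_top.
  by rewrite SubK; case: HT => -[E _]; [left|right].
(* The flag starting with [r, X, q] has [A] as an initial segment. Its first [i] entries contain a
   label outside [T]: [r] in the first case, [q] in the second. *)
- have us : uniq (r :: rcons X q).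
    by rewrite /= mem_rcons inE negb_or eq_sym qr rX rcons_uniq qX.
  have sz : (size X < size (r :: rcons X q))%N by rewrite /= size_rcons leqW.
  have ES : val A = [set x in take #|val A| (r :: rcons X q)].
    by rewrite cA EA /= -cats1 takel_cat // take_size.
  case: HT => [[E [zi ri]]|[E qi]].
    have Ei : (size X).+1 = i by apply: (sizeT (q :: X)) => //=; rewrite qX.
    apply: (exists_flagpt C us _ _ ri _ ES); rewrite ?cA /= ?size_rcons //; first by rewrite -Ei.
    by rewrite -Ei /= mem_head.
  have Ei : (size X).+2 = i by apply: (sizeT [:: z, r & X]) => //=; rewrite inE negb_or zr zX rX.
  apply: (exists_flagpt C us _ _ qi _ ES); rewrite ?cA /= ?size_rcons //; first by rewrite -Ei.
  by rewrite -Ei take_oversize /= ?size_rcons // inE mem_rcons mem_head orbT.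
(* The flag starting with [z, q, X] has [B] as an initial segment; the label outside [T] is now [z]
   in the first case and [q] in the second. *)
have ES : val B = [set x in take #|val B| [:: z, q & X]] by rewrite cB EB /= take_size.
case: HT => [[E [zi ri]]|[E qi]].
  have Ei : (size X).+1 = i by apply: (sizeT (q :: X)) => //=; rewrite qX.
  apply: (exists_flagpt C uB _ _ zi _ ES); rewrite ?cB //=; first by rewrite -Ei.
  by rewrite -Ei /= mem_head.
have Ei : (size X).+2 = i by apply: (sizeT [:: z, r & X]) => //=; rewrite inE negb_or zr zX rX.
apply: (exists_flagpt C uB _ _ qi _ ES); rewrite ?cB //=; first by rewrite -Ei.
by rewrite -Ei take_oversize //= !inE eqxx orbT.
Qed.

End Divisor.

(* i : 'I_n with 0 < i encodes i in [n-1]; w s_i = w0 is stated pointwise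
   as composition: w (s_i a) = w0 a for all a. *)
Theorem theorem6p1 (R : realType) (n : nat) (i : 'I_n) (w : 'S_n) :
  (2 < n)%N -> (0 < i)%N ->
  (forall a : 'I_n, w (sref i a) = w0 n a) ->
  (odd n -> val i <> (n.+1)./2) ->
  reducible (@degSchubert R[i] n w).
Proof.
move=> n2 i0 wE Hodd; have ilt := ltn_ord i.
have [T mT] : exists T : {set 'I_n}, forall y, (y \in T) = (n - i <= y)%N.
  by exists [set y : 'I_n | (n - i <= y)%N] => y; rewrite inE.
have cT : #|T| = i.
  rewrite -size_sorted_vals (@sorted_vals_eq _ _ (iota (n - i) i)) ?size_iota //.
  - exact: iota_ltn_sorted.
  - by move=> y; rewrite mem_iota; lia.
  by move=> y; rewrite mT mem_iota /=; have := ltn_ord y; lia.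
have ord k : (k < n)%N -> exists y : 'I_n, y = k :> nat by move=> kn; exists (Ordinal kn).
(* The excluded value [2 * i = n + 1] would force [n] odd and [i = (n + 1) / 2]. *)
have [ile|ige] : (2 * i <= n \/ n + 2 <= 2 * i)%N.
  case: (eqVneq (2 * i)%N n.+1) => E; last by lia.
  exfalso; apply: Hodd; last by rewrite -E mul2n doubleK.
  by have := congr1 odd E; rewrite mul2n odd_double => /esym/negbFE.
(* With [X = T :\ q], [z] must equal [size X = i - 1], and [2 * i <= n] puts it outside [T]. The
   boolean defining [r] is 1 for [i = 1] and 0 otherwise: the least ordinal other than [z]. *)
- have [z Ez] := ord i.-1 ltac:(lia).
  have [q Eq] := ord n.-1 ltac:(lia).
  have [r Er] := ord (nat_of_ord i == 1%N) ltac:(lia).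
  have qT : q \in T by rewrite mT; lia.
  have rT : r \notin T by rewrite mT; lia.
  have zT : z \notin T by rewrite mT; lia.
  have zr : z != r by rewrite -val_eqE /=; lia.
  have sX : size (enum (T :\ q)) = i.-1.
    by rewrite -cardE -cT (cardsD1 q T) qT.
  apply: (@reducible_of_three_term n i w i0 wE _ T z q r (enum (T :\ q))) => //.
  + have zq : z != q by apply: contraNneq zT => ->.
    have qr : q != r by apply: contraNneq rT => <-.
    rewrite /= !in_cons !mem_enum !in_setD1 enum_uniq (negPf zq) (negPf zr) (negPf qr).
    by rewrite eqxx (negPf rT) (negPf zT) !andbF.
  + by rewrite sX /= Ez.
  + by rewrite sX; lia.
  left; split; last by lia.
  by apply/setP => y; rewrite !inE mem_enum !inE; case: eqVneq => [->|//]; rewrite qT.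
(* Now [X] is [T] without [z] and [r], so [z = size X = i - 2], which lies in [T] because
   [n + 2 <= 2 * i]; [q = 0] is outside [T] because [i < n]. *)
have [z Ez] := ord i.-2 ltac:(lia).
have [r Er] := ord n.-1 ltac:(lia).
have [q Eq] := ord 0%N ltac:(lia).
have zT : z \in T by rewrite mT; lia.
have rT : r \in T by rewrite mT; lia.
have qT : q \notin T by rewrite mT; lia.
have zr : z != r by rewrite -val_eqE /=; lia.
have rT' : r \in T :\ z by rewrite in_setD1 eq_sym zr rT.
have sX : size (enum (T :\ z :\ r)) = i.-2.
  by rewrite -cardE -cT (cardsD1 z T) (cardsD1 r (T :\ z)) zT rT'.
apply: (@reducible_of_three_term n i w i0 wE _ T z q r (enum (T :\ z :\ r))) => //.
- have zq : z != q by apply: contraNneq qT => <-.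
  have qr : q != r by apply: contraNneq qT => ->.
  rewrite /= !in_cons !mem_enum !in_setD1 enum_uniq (negPf zq) (negPf zr) (negPf qr).
  by rewrite !eqxx (negPf qT) !andbF.
- by rewrite sX /= Ez.
- by rewrite sX; lia.
right; split; last by lia.
apply/setP => y; rewrite !inE mem_enum !inE.
by case: (eqVneq y z) => [->|_] //; case: (eqVneq y r) => [->|_].
Qed.
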